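(* Let $\mathcal C,\mathcal D$ be stable configuration structures. Then $\mathcal C$ and $\mathcal D$ are hereditary history-preserving (HH) bisimilar if and only if $\mathcal C \equiv_{\mathrm{EIL}} \mathcal D$, i.e. for every closed formula $\phi$ of Event Identifier Logic, $\mathcal C\models\phi$ iff $\mathcal D\models\phi$.
   Context: Configuration structures. A configuration structure over a label alphabet $\mathsf{Act}$ is a pair $\mathcal C=(C,\ell)$ where $C$ is a family of finite sets (configurations) and $\ell:\bigcup_{X\in C}X\to\mathsf{Act}$ is a labelling; $E_{\mathcal C}=\bigcup_{X\in C}X$ is its set of events. It is stable if: $\emptyset\in C$; every nonempty $X\in C$ has some $e\in X$ with $X\setminus\{e\}\in C$; and whenever $X,Y,Z\in C$ with $X\cup Y\subseteq Z$, both $X\cup Y\in C$ and $X\cap Y\in C$. For $X\in C$ define $d\le_X e$ iff for all $Y\in C$ with $Y\subseteq X$, $e\in Y$ implies $d\in Y$; $d<_X e$ iff $d\le_X e$ and $d\ne e$. Write $X\xrightarrow{e}X'$ iff $X,X'\in C$, $X\subseteq X'$ and $X'\setminus X=\{e\}$; $X\xrightarrow{a}X'$ iff $X\xrightarrow{e}X'$ for some $e$ with $\ell(e)=a$. Standing assumption: structures are image finite, i.e. for every configuration $X$ and label $a$ the set $\{X' : X\xrightarrow{a}X'\}$ is finite. For configurations $X$ of $\mathcal C$ and $Y$ of $\mathcal D$, $f:X\cong Y$ means $f$ is a label-preserving bijection $X\to Y$ with $d<_X e\iff f(d)<_Y f(e)$. HH bisimulation. A relation $\mathcal R\subseteq C_{\mathcal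 C}\times C_{\mathcal D}\times\mathcal P(E_{\mathcal C}\times E_{\mathcal D})$ is an HH bisimulation if $\mathcal R(\emptyset,\emptyset,\emptyset)$ and whenever $\mathcal R(X,Y,f)$ and $a\in\mathsf{Act}$: $f:X\cong Y$; if $X\xrightarrow{a}X'$ then there are $Y',f'$ with $Y\xrightarrow{a}Y'$, $\mathcal R(X',Y',f')$ and $f'\restriction X=f$, and symmetrically for moves $Y\xrightarrow{a}Y'$; if $X'\xrightarrow{a}X$ then there are $Y',f'$ with $Y'\xrightarrow{a}Y$, $\mathcal R(X',Y',f')$ and $f\restriction X'=f'$, and symmetrically for $Y'\xrightarrow{a}Y$. $\mathcal C,\mathcal D$ are HH bisimilar if such a relation exists. Event Identifier Logic (EIL). Fix an infinite set of identifiers. Syntax: $\phi::=\mathrm{tt}\mid\neg\phi\mid\phi\wedge\phi'\mid\langle x:a\rangle\phi\mid(x:a)\phi\mid\langle\!\langle x\rangle\!\rangle\phi$ (forward diamond, declaration, reverse diamond). $\langle x:a\rangle$ and $(x:a)$ bind $x$ in $\phi$; $\langle\!\langle x\rangle\!\rangle$ does not bind. Free identifiers: $\mathrm{fi}(\mathrm{tt})=\emptyset$, $\mathrm{fi}(\neg\phi)=\mathrm{fi}(\phi)$, $\mathrm{fi}(\phi_1\wedge\phi_2)=\mathrm{fi}(\phi_1)\cup\mathrm{fi}(\phi_2)$, $\mathrm{fi}(\langle x:a\rangle\phi)=\mathrm{fi}((x:a)\phi)=\mathrm{fi}(\phi)\setminus\{x\}$, $\mathrm{fi}(\langle\!\langle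 x\rangle\!\rangle\phi)=\mathrm{fi}(\phi)\cup\{x\}$; $\phi$ is closed if $\mathrm{fi}(\phi)=\emptyset$. An environment $\rho$ is a partial map from identifiers to events; it is permissible for $\phi$ and $X$ if $\mathrm{fi}(\phi)\subseteq\mathrm{dom}(\rho)$ and $\rho(\mathrm{fi}(\phi))\subseteq X$. $\rho[x\mapsto e]$ is $\rho$ updated at $x$. For $X$ a configuration and $\rho$ permissible for $\phi$ and $X$: $X,\rho\models\mathrm{tt}$ always; $X,\rho\models\neg\phi$ iff not $X,\rho\models\phi$; $X,\rho\models\phi_1\wedge\phi_2$ iff both; $X,\rho\models\langle x:a\rangle\phi$ iff there are $X',e$ with $X\xrightarrow{e}X'$, $\ell(e)=a$ and $X',\rho[x\mapsto e]\models\phi$; $X,\rho\models(x:a)\phi$ iff there is $e\in X$ with $\ell(e)=a$ and $X,\rho[x\mapsto e]\models\phi$; $X,\rho\models\langle\!\langle x\rangle\!\rangle\phi$ iff there are $X',e$ with $X'\xrightarrow{e}X$, $\rho(x)=e$, $\rho$ permissible for $\phi$ and $X'$, and $X',\rho\models\phi$. For closed $\phi$: $\mathcal C\models\phi$ iff $\emptyset,\emptyset\models\phi$ (empty configuration, empty environment). For a set $L$ of formulas, $\mathcal C\equiv_L\mathcal D$ iff for all closed $\phi\in L$, $\mathcal C\models\phi\iff\mathcal D\models\phi$. *)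

(* Defs.v *)
(* MathComp world: finite sets from finmap, classical sets from classical_sets. *)
From HB Require Import structures.
From mathcomp Require Import all_boot.
From mathcomp Require Import finmap.
From mathcomp Require Import boolp classical_sets functions cardinality.

Set Implicit Arguments.
Unset Strict Implicit.
Unset Printing Implicit Defensive.

Local Open Scope fset_scope.

(* The labelling is a function on the union of the configurations; here it is
   total on the ambient type E, but only its values on members of
   configurations are ever used. *)
Record conf_struct (Act : Type) (E : choiceType) := ConfStruct {
  config : set {fset E};
  label : E -> Act
}.

Definition stable (Act : Type) (E : choiceType) (C : conf_struct Act E) : Prop :=
  [/\ config C fset0,
      (forall X : {fset E}, config C X -> X <> fset0 ->
         exists2 e : E, e \in X & config C (X `\ e)) &
      (forall X Y Z : {fset E}, config C X -> config C Y -> config C Z ->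
         X `|` Y `<=` Z -> config C (X `|` Y) /\ config C (X `&` Y))].

Definition event_le (Act : Type) (E : choiceType) (C : conf_struct Act E)
    (X : {fset E}) (d e : E) : Prop :=
  forall Y : {fset E}, config C Y -> Y `<=` X -> e \in Y -> d \in Y.

Definition event_lt (Act : Type) (E : choiceType) (C : conf_struct Act E)
    (X : {fset E}) (d e : E) : Prop :=
  event_le C X d e /\ d <> e.

Definition step (Act : Type) (E : choiceType) (C : conf_struct Act E)
    (X : {fset E}) (e : E) (X' : {fset E}) : Prop :=
  [/\ config C X, config C X', X `<=` X' & X' `\` X = [fset e]].

Definition lstep (Act : Type) (E : choiceType) (C : conf_struct Act E)
    (X : {fset E}) (a : Act) (X' : {fset E}) : Prop :=
  exists2 e : E, step C X e X' & label C e = a.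

Definition image_finite (Act : Type) (E : choiceType) (C : conf_struct Act E) :
    Prop :=
  forall (X : {fset E}) (a : Act), config C X ->
    finite_set (lstep C X a : set {fset E}).

(* The bijection f is given by its graph. *)
Definition conf_iso (Act : Type) (E F : choiceType)
    (C : conf_struct Act E) (D : conf_struct Act F)
    (X : {fset E}) (Y : {fset F}) (f : set (E * F)) : Prop :=
  [/\ [/\ (forall d d', f (d, d') -> d \in X /\ d' \in Y),
          (forall d, d \in X -> exists! d', f (d, d')) &
          (forall d', d' \in Y -> exists! d, f (d, d'))],
      (forall d d', f (d, d') -> label C d = label D d') &
      (forall d e d' e', f (d, d') -> f (e, e') ->
         (event_lt C X d e <-> event_lt D Y d' e'))].

Definition restrict_dom (E F : choiceType) (f : set (E * F)) (X : {fset E}) :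
    set (E * F) :=
  [set p | f p /\ p.1 \in X]%classic.

Definition is_HH_bisim (Act : Type) (E F : choiceType)
    (C : conf_struct Act E) (D : conf_struct Act F)
    (R : {fset E} -> {fset F} -> set (E * F) -> Prop) : Prop :=
  R fset0 fset0 set0 /\
  forall (X : {fset E}) (Y : {fset F}) (f : set (E * F)), R X Y f ->
    [/\ config C X, config D Y, conf_iso C D X Y f,
        (forall a,
          (forall X', lstep C X a X' -> exists Y' f',
             [/\ lstep D Y a Y', R X' Y' f' & restrict_dom f' X = f]) /\
          (forall Y', lstep D Y a Y' -> exists X' f',
             [/\ lstep C X a X', R X' Y' f' & restrict_dom f' X = f])) &
        (forall a,
          (forall X', lstep C X' a X -> exists Y' f',
             [/\ lstep D Y' a Y, R X' Y' f' & restrict_dom f X' = f']) /\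
          (forall Y', lstep D Y' a Y -> exists X' f',
             [/\ lstep C X' a X, R X' Y' f' & restrict_dom f X' = f']))].

Definition HH_bisimilar (Act : Type) (E F : choiceType)
    (C : conf_struct Act E) (D : conf_struct Act F) : Prop :=
  exists R : {fset E} -> {fset F} -> set (E * F) -> Prop, is_HH_bisim C D R.

(* EFwd x a phi is <x:a>phi, EDecl x a phi is (x:a)phi, ERev x phi is <<x>>phi. *)
Inductive eil (Id Act : Type) : Type :=
  | ETrue
  | ENot of eil Id Act
  | EAnd of eil Id Act & eil Id Act
  | EFwd of Id & Act & eil Id Act
  | EDecl of Id & Act & eil Id Act
  | ERev of Id & eil Id Act.

Arguments ETrue {Id Act}.

Fixpoint fi (Id : choiceType) (Act : Type) (phi : eil Id Act) : {fset Id} :=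
  match phi with
  | ETrue => fset0
  | ENot phi1 => fi phi1
  | EAnd phi1 phi2 => fi phi1 `|` fi phi2
  | EFwd x _ phi1 => fi phi1 `\ x
  | EDecl x _ phi1 => fi phi1 `\ x
  | ERev x phi1 => x |` fi phi1
  end.

Definition closed_eil (Id : choiceType) (Act : Type) (phi : eil Id Act) : Prop :=
  fi phi = fset0.

Definition env (Id E : Type) := Id -> option E.

Definition empty_env (Id E : Type) : env Id E := fun=> None.

Definition update (Id : choiceType) (E : Type) (rho : env Id E) (x : Id) (e : E) :
    env Id E :=
  fun y => if y == x then Some e else rho y.

Definition permissible (Id : choiceType) (Act : Type) (E : choiceType)
    (rho : env Id E) (phi : eil Id Act) (X : {fset E}) : Prop :=
  (forall x : Id, x \in fi phi -> exists e : E, rho x = Some e) /\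
  (forall (x : Id) (e : E), x \in fi phi -> rho x = Some e -> e \in X).

(* Only meaningful when config C X and permissible rho phi X hold; started from
   such a triple, every recursive call is again on such a triple: only the
   reverse diamond needs this to be required explicitly. *)
Fixpoint sat (Id : choiceType) (Act : Type) (E : choiceType)
    (C : conf_struct Act E) (X : {fset E}) (rho : env Id E) (phi : eil Id Act) :
    Prop :=
  match phi with
  | ETrue => True
  | ENot phi1 => ~ sat C X rho phi1
  | EAnd phi1 phi2 => sat C X rho phi1 /\ sat C X rho phi2
  | EFwd x a phi1 => exists (X' : {fset E}) (e : E),
      [/\ step C X e X', label C e = a & sat C X' (update rho x e) phi1]
  | EDecl x a phi1 => exists e : E,
      [/\ e \in X, label C e = a & sat C X (update rho x e) phi1]
  | ERev x phi1 => exists (X' : {fset E}) (e : E),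
      [/\ step C X' e X, rho x = Some e, permissible rho phi1 X' &
          sat C X' rho phi1]
  end.

Definition models (Id : choiceType) (Act : Type) (E : choiceType)
    (C : conf_struct Act E) (phi : eil Id Act) : Prop :=
  sat C fset0 (@empty_env Id E) phi.

Definition logic_equiv (Id : choiceType) (Act : Type) (E F : choiceType)
    (L : set (eil Id Act)) (C : conf_struct Act E) (D : conf_struct Act F) :
    Prop :=
  forall phi : eil Id Act, L phi -> closed_eil phi -> (models C phi <-> models D phi).

(* Main.v *)
(** From a bisimulation to logical equivalence: related triples [(X, Y, f)]
    satisfy the same formulas under environments that correspond along [f], by
    induction on the formula.

    Conversely, relate [X] and [Y] when a finite set [s] of identifiers names
    the events of both bijectively, with equal labels, and [X] and [Y] satisfy
    the same formulas with free identifiers in [s]; [f] is then read off the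
    names.  A forward move is matched by the usual Hennessy-Milner argument with
    a fresh identifier and a finite conjunction.  A reverse move by a named
    event is deterministic.  In a stable structure every subconfiguration of [X]
    is reached from [X] by reverse moves, so related configurations have
    corresponding subconfigurations; as these determine the causal order, [f] is
    an isomorphism. *)
Require Import Defs.
From mathcomp Require Import all_boot.
From mathcomp Require Import finmap.
From mathcomp Require Import boolp classical_sets functions cardinality.

Set Implicit Arguments.
Unset Strict Implicit.
Unset Printing Implicit Defensive.

Local Open Scope fset_scope.

(** * Steps as insertion or removal of a single event *)

Lemma stepE (Act : Type) (E : choiceType) (C : conf_struct Act E) X e X' :
  step C X e X' <-> [/\ config C X, config C X', e \notin X & X' = e |` X].
Proof.
split=> [[CX CX' sXX' dXX']|[CX CX' eX X'E]].
  have /fsetDP[eX' eX] : e \in X' `\` X by rewrite dXX' fset11.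
  split=> //; apply/fsetP=> d; have := congr1 (fun A => d \in A) dXX'.
  rewrite !inE => <-; have [/(fsubsetP sXX') ->|dX] := boolP (d \in X) => //.
  by rewrite orbF.
split; rewrite // X'E ?fsubsetU1 //.
by apply/fsetP=> d; rewrite !inE; case: eqP => [->|_]; rewrite ?eX //; case: (d \in X).
Qed.

Lemma step_revE (Act : Type) (E : choiceType) (C : conf_struct Act E) X e X' :
  step C X' e X <->
  [/\ config C X, config C X', e \in X & X' = X `\ e].
Proof.
split=> [/stepE[CX' CX eX' XE]|[CX CX' eX X'E]].
  by rewrite XE fset1U1 -XE; split=> //; rewrite XE fsetU1K.
by apply/stepE; split=> //; rewrite X'E ?fsetD1K // !inE eqxx.
Qed.

(** * Exchanging the two structures *)

Definition flip (A B : Type) (f : set (A * B)) : set (B * A) :=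
  [set p | f (p.2, p.1)]%classic.

Lemma flipK (A B : Type) (f : set (A * B)) : flip (flip f) = f.
Proof. by apply/funext=> -[]. Qed.

Section Isomorphisms.
Context {Act : Type} {E F : choiceType}.
Implicit Types (C : conf_struct Act E) (D : conf_struct Act F).
Implicit Types (X : {fset E}) (Y : {fset F}).

Lemma conf_iso_flip C D X Y f :
  conf_iso C D X Y f -> conf_iso D C Y X (flip f).
Proof.
move=> [[dom fX fY] lab ord]; split; first split=> //.
- by move=> d d' /dom[].
- by move=> d d' /lab.
- by move=> d e d' e' fd fe; rewrite (ord _ _ _ _ fd fe).
Qed.

Lemma conf_iso_functional C D X Y f d d1 d2 :
  conf_iso C D X Y f -> f (d, d1) -> f (d, d2) -> d1 = d2.
Proof.
move=> [[dom fX _] _ _] f1 f2.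
have [d' [_ uniq_d']] := fX d (dom _ _ f1).1.
by rewrite -(uniq_d' _ f1) (uniq_d' _ f2).
Qed.

End Isomorphisms.

Section Symmetry.
Context {Act : Type} {E F : choiceType}.
Implicit Types (C : conf_struct Act E) (D : conf_struct Act F).
Implicit Types (X : {fset E}) (Y : {fset F}).

Lemma conf_iso_injective C D X Y f d1 d2 d' :
  conf_iso C D X Y f -> f (d1, d') -> f (d2, d') -> d1 = d2.
Proof. by move=> /conf_iso_flip /conf_iso_functional; apply. Qed.

(** Bisimulations restrict graphs by their first component only; this turns restriction to [X] into
    restriction to [Y]. A pair of [f'] ending in [Y] must start in [X], since [f] already covers [Y]
    and [f'] is injective. *)
Lemma restrict_mem C D X Y f X' Y' f' d d' :
  conf_iso C D X Y f -> conf_iso C D X' Y' f' -> restrict_dom f' X = f ->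
  f' (d, d') -> (d \in X) = (d' \in Y).
Proof.
move=> isof isof' fE fd; have [[dom _ fY] _ _] := isof.
apply/idP/idP => [dX|d'Y]; first by have /dom[] : f (d, d') by rewrite -fE.
have [e [fe _]] := fY _ d'Y; have [eX _] := dom _ _ fe.
move: fe; rewrite -fE => -[/= f'e _].
by rewrite (conf_iso_injective isof' fd f'e).
Qed.

Lemma restrict_flip C D X Y f X' Y' f' :
  conf_iso C D X Y f -> conf_iso C D X' Y' f' -> restrict_dom f' X = f ->
  restrict_dom (flip f') Y = flip f.
Proof.
move=> isof isof' fE; rewrite -[in RHS]fE; apply/seteqP; split=> -[d' d] [/= fd].
  by rewrite -(restrict_mem isof isof' fE fd).
by rewrite (restrict_mem isof isof' fE fd).
Qed.

Lemma HH_bisim_flip C D R :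
  is_HH_bisim C D R -> is_HH_bisim D C (fun Y X g => R X Y (flip g)).
Proof.
move=> [R0 RS]; split.
  by rewrite (_ : flip _ = set0) //; apply/seteqP; split=> p [].
move=> Y X g Rg; have [CX DY isog fwd bwd] := RS _ _ _ Rg.
have iso X1 Y1 f : R X1 Y1 f -> conf_iso C D X1 Y1 f by case/RS.
split=> // [|a|a]; first by rewrite -[g]flipK; exact: conf_iso_flip.
- have [fwdl fwdr] := fwd a; split.
  + move=> Y' /fwdr[X' [f' [st Rf' fE]]]; exists X', (flip f').
    by rewrite flipK (restrict_flip isog (iso _ _ _ Rf') fE) flipK.
  + move=> X' /fwdl[Y' [f' [st Rf' fE]]]; exists Y', (flip f').
    by rewrite flipK (restrict_flip isog (iso _ _ _ Rf') fE) flipK.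
- have [bwdl bwdr] := bwd a; split.
  + move=> Y' /bwdr[X' [f' [st Rf' fE]]]; exists X', (flip f').
    by rewrite flipK -(restrict_flip (iso _ _ _ Rf') isog fE) flipK.
  + move=> X' /bwdl[Y' [f' [st Rf' fE]]]; exists Y', (flip f').
    by rewrite flipK -(restrict_flip (iso _ _ _ Rf') isog fE) flipK.
Qed.

End Symmetry.

(** * Bisimilar structures satisfy the same formulas *)

Definition corresponding (Id : choiceType) (E F : Type) (f : set (E * F))
    (s : {fset Id}) (rho : env Id E) (sigma : env Id F) : Prop :=
  forall x, x \in s ->
    exists d d', [/\ rho x = Some d, sigma x = Some d' & f (d, d')].

Lemma corresponding_update (Id : choiceType) (E F : Type) (f f' : set (E * F))
    (s : {fset Id}) (rho : env Id E) (sigma : env Id F) x d d' :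
  (f `<=` f')%classic -> f' (d, d') -> corresponding f (s `\ x) rho sigma ->
  corresponding f' s (update rho x d) (update sigma x d').
Proof.
move=> sff' fd cor y ys; rewrite /update; case: eqP => [_|/eqP yx].
  by exists d, d'.
have [|e [e' [? ? /sff' ?]]] := cor y; first by rewrite !inE yx.
by exists e, e'.
Qed.

(** One implication suffices, provided the induction hypothesis ranges over all structures and
    relations: the case of negation applies it to the flipped bisimulation. *)
Lemma HH_bisim_sat (Id : choiceType) (Act : Type) (phi : eil Id Act) :
  forall (E F : choiceType) (C : conf_struct Act E) (D : conf_struct Act F) R
    X Y f (rho : env Id E) (sigma : env Id F),
    is_HH_bisim C D R -> R X Y f -> corresponding f (fi phi) rho sigma ->
    sat C X rho phi -> sat D Y sigma phi.
Proof.
elim: phi => [//|phi IH|phi1 IH1 phi2 IH2|x a phi IH|x a phi IH|x phi IH]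
  E F C D R X Y f rho sigma HH RXY cor /=;
  have [CX DY isof fwd bwd] := HH.2 _ _ _ RXY.
- move=> nsat satD; apply: nsat.
  apply: (IH _ _ _ _ _ _ _ (flip f) _ _ (HH_bisim_flip HH) _ _ satD).
    by rewrite flipK.
  by move=> x /cor[d [d' [? ? ?]]]; exists d', d.
- move=> [sat1 sat2]; split.
    apply: (IH1 _ _ _ _ _ _ _ _ _ _ HH RXY _ sat1) => x xphi.
    by apply: cor; rewrite /= !inE xphi.
  apply: (IH2 _ _ _ _ _ _ _ _ _ _ HH RXY _ sat2) => x xphi.
  by apply: cor; rewrite /= !inE xphi orbT.
- move=> [X' [e [st ea satX']]].
  have [|Y' [f' [[e' st' e'a] Rf' fE]]] := (fwd a).1 X'; first by exists e.
  exists Y', e'; split=> //; apply: (IH _ _ _ _ _ _ _ _ _ _ HH Rf' _ satX').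
  have [_ _ isof' _ _] := HH.2 _ _ _ Rf'.
  apply: (corresponding_update _ _ cor); first by rewrite -fE => p [].
  (* As [e] lies outside [X], its image under [f'] lies outside [Y], so it is the only event added
     there, namely [e']. *)
  move: st st' => /stepE[_ _ eX X'E] /stepE[_ _ e'Y Y'E].
  have [[dom f'X _] _ _] := isof'.
  have [|d' [f'e _]] := f'X e; first by rewrite X'E !inE eqxx.
  have := restrict_mem isof isof' fE f'e; rewrite (negbTE eX).
  by have [_] := dom _ _ f'e; rewrite Y'E !inE => /orP[/eqP <-|->].
- move=> [e [eX ea satX]]; have [[dom fX _] lab _] := isof.
  have [e' [fe _]] := fX e eX; exists e'; split.
  + by have [] := dom _ _ fe.
  + by rewrite -(lab _ _ fe).
  + exact: (IH _ _ _ _ _ _ _ _ _ _ HH RXY (corresponding_update _ fe cor) satX).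
- move=> [X' [e [st rhox [_ perm] satX']]].
  have [|Y' [f' [[e' st' _] Rf' f'E]]] := (bwd (label C e)).1 X'.
    by exists e.
  have [_ _ isof' _ _] := HH.2 _ _ _ Rf'.
  (* Permissibility keeps the events named in [phi] inside [X'], so their pairs survive the
     restriction of [f] to [X']. *)
  have cor' : corresponding f' (fi phi) rho sigma.
    move=> y yphi; have [|d [d' [rhoy sigmay fd]]] := cor y.
      by rewrite /= !inE yphi orbT.
    by exists d, d'; split=> //; rewrite -f'E; split=> //; exact: perm rhoy.
  exists Y', e'; split=> //.
  (* The partner of the removed event [e] is outside [Y'], hence equal to the removed event [e']. *)
  + have [|d [d' []]] := cor x; first by rewrite /= !inE eqxx.
    rewrite rhox => -[<-] -> fe.
    move: st st' => /stepE[_ _ eX _] /stepE[_ _ _ YE].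
    have := restrict_mem isof' isof f'E fe; rewrite (negbTE eX).
    have [[dom _ _] _ _] := isof.
    by have [_] := dom _ _ fe; rewrite YE !inE => /orP[/eqP ->|->].
  + have [[dom _ _] _ _] := isof'.
    split=> y => [/cor'[d [d' []]]|e1 /cor'[d [d' [_ -> /dom[_ d'Y]]]]].
      by exists d'.
    by case=> <-.
  + exact: (IH _ _ _ _ _ _ _ _ _ _ HH Rf' cor' satX').
Qed.

Lemma HH_bisimilar_models (Id : choiceType) (Act : Type) (E F : choiceType)
    (C : conf_struct Act E) (D : conf_struct Act F) (phi : eil Id Act) :
  HH_bisimilar C D -> closed_eil phi -> models C phi <-> models D phi.
Proof.
move=> [R HH] clphi.
have cor (A B : Type) g : corresponding (g : set (A * B)) (fi phi)
    (@empty_env Id A) (@empty_env Id B) by move=> x; rewrite clphi.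
split; first exact: (HH_bisim_sat HH HH.1 (cor _ _ _)).
have HH' := HH_bisim_flip HH; exact: (HH_bisim_sat HH' HH'.1 (cor _ _ _)).
Qed.

(** * Reverse reachability *)

(** Undo the events of [X] one by one, passing over those in [Z]. At the first [e] outside [Z], the
    set [X] without [e] is the union of [Z] and the configuration just reached; it is bounded by
    [X], so stability makes it a configuration. *)
Lemma stable_remove (Act : Type) (E : choiceType) (C : conf_struct Act E)
    (X Z : {fset E}) :
  stable C -> config C X -> config C Z -> Z `<` X ->
  exists e, [/\ e \in X, e \notin Z & config C (X `\ e)].
Proof.
move=> [_ rem cup] CX CZ ltZX; have sZX := fproper_sub ltZX.
(* [W] runs down a chain of configurations from [X] to the empty one. *)
suff main n : forall W, #|` W| = n -> config C W -> Z `|` W = X ->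
    exists e, [/\ e \in X, e \notin Z & config C (X `\ e)].
  by apply: (main _ X) => //; apply/fsetUidPr.
elim: n => [|n IH] W cardW CW ZW.
  by move: ltZX; rewrite -ZW (cardfs0_eq cardW) fsetU0 fproperEneq eqxx.
have [W0|e eW CWe] := rem W CW; first by rewrite W0 cardfs0 in cardW.
have [eZ|eZ] := boolP (e \in Z).
  apply: (IH (W `\ e)) => //; first by move: cardW; rewrite (cardfsD1 e) eW => -[].
  by rewrite -ZW; apply/fsetP=> d; rewrite !inE; case: eqP => [->|//]; rewrite eZ.
exists e; split=> //; first by rewrite -ZW !inE eW orbT.
have ZWe : Z `|` (W `\ e) = X `\ e.
  rewrite -ZW; apply/fsetP=> d; rewrite !inE.
  by case: eqP => [->|//]; rewrite (negbTE eZ).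
rewrite -ZWe; apply: (cup _ _ X CZ CWe CX _).1.
by rewrite ZWe fsubD1set.
Qed.

(** * Matching configurations by names *)

(** Nothing is asked of [rho] outside [s], so a reverse move shrinks [s] and leaves the environment
    alone. *)
Definition names (Id E : choiceType) (s : {fset Id}) (rho : env Id E)
    (X : {fset E}) : Prop :=
  [/\ forall x, x \in s -> exists2 e, e \in X & rho x = Some e,
      forall e, e \in X -> exists2 x, x \in s & rho x = Some e &
      forall x y e, x \in s -> y \in s -> rho x = Some e -> rho y = Some e ->
        x = y].

Lemma names_mem (Id E : choiceType) (s : {fset Id}) (rho : env Id E) X x e :
  names s rho X -> x \in s -> rho x = Some e -> e \in X.
Proof. by move=> [nam _ _] /nam[d dX ->] [<-]. Qed.

Lemma names_update (Id E : choiceType) (s : {fset Id}) (rho : env Id E) X z e :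
  names s rho X -> z \notin s -> e \notin X ->
  names (z |` s) (update rho z e) (e |` X).
Proof.
move=> namX zs eX; have [nam sur inj] := namX.
have neq x d : x \in s -> rho x = Some d -> d != e.
  by move=> xs /(names_mem namX xs); apply: contraL => /eqP ->.
rewrite /update; split=> [x|d|x y d]; rewrite !inE.
- case: eqP => [_ _|_ /nam[d dX ->]]; first by exists e; rewrite ?inE ?eqxx.
  by exists d; rewrite // !inE dX orbT.
- case: eqP => [-> _|_ /sur[x xs rhox]]; first by exists z; rewrite ?inE eqxx.
  by exists x; rewrite ?inE ?xs ?orbT //; case: eqP zs => // <-; rewrite xs.
- case: eqP => [-> _|_ xs]; case: eqP => [-> _|_ ys] //.
  + by move=> [<-] /(neq _ _ ys); rewrite eqxx.
  + by move=> /(neq _ _ xs) /eqP ne [/esym].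
  + exact: inj.
Qed.

Lemma names_remove (Id E : choiceType) (s : {fset Id}) (rho : env Id E) X x e :
  names s rho X -> x \in s -> rho x = Some e -> names (s `\ x) rho (X `\ e).
Proof.
move=> [nam sur inj] xs rhox; split=> [y|d|y z d]; rewrite !inE.
- move=> /andP[yx ys]; have [d dX rhoy] := nam y ys; exists d => //.
  rewrite !inE dX andbT; apply: contra_neq yx => de.
  by apply: (inj _ _ e); rewrite // -de.
- move=> /andP[de /sur[y ys rhoy]]; exists y => //.
  rewrite !inE ys andbT; apply: contra_neq de => yx.
  by move: rhoy; rewrite yx rhox => -[].
- by move=> /andP[_ ys] /andP[_ zs]; exact: inj.
Qed.

(** For [phi] with free identifiers in [s], the two [names] conditions make both environments
    permissible, so [sat] is meaningful on both sides. *)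
Definition matched (Id : choiceType) (Act : Type) (E F : choiceType)
    (C : conf_struct Act E) (D : conf_struct Act F) (s : {fset Id})
    (X : {fset E}) (rho : env Id E) (Y : {fset F}) (sigma : env Id F) : Prop :=
  [/\ config C X /\ config D Y, names s rho X, names s sigma Y,
      forall x d d', x \in s -> rho x = Some d -> sigma x = Some d' ->
        label C d = label D d' &
      forall phi : eil Id Act, fi phi `<=` s ->
        sat C X rho phi <-> sat D Y sigma phi].

Lemma matched_sym (Id : choiceType) (Act : Type) (E F : choiceType)
    (C : conf_struct Act E) (D : conf_struct Act F) (s : {fset Id}) X rho Y sigma :
  matched C D s X rho Y sigma -> matched D C s Y sigma X rho.
Proof.
move=> [[CX DY] nX nY lab eqsat]; split=> // [x d d' xs rx sx|phi /eqsat ->//].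
by rewrite (lab x d' d).
Qed.

(** The test formulas are [ERev x phi]: as [x] names [d], such a formula says exactly that [d] can
    be undone and that [phi] holds afterwards. *)
Lemma matched_backward (Id : choiceType) (Act : Type) (E F : choiceType)
    (C : conf_struct Act E) (D : conf_struct Act F) (s : {fset Id})
    X rho Y sigma x d d' :
  matched C D s X rho Y sigma -> x \in s -> rho x = Some d ->
  sigma x = Some d' -> config C (X `\ d) ->
  matched C D (s `\ x) (X `\ d) rho (Y `\ d') sigma.
Proof.
move=> [[CX DY] nX nY lab eqsat] xs rhox sigmax CXd.
have satRev (G : choiceType) (B : conf_struct Act G) V tau g phi :
    config B V -> names s tau V -> tau x = Some g -> fi phi `<=` s `\ x ->
    sat B V tau (ERev x phi) <-> config B (V `\ g) /\ sat B (V `\ g) tau phi.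
  move=> BV nV taux sphi /=; split.
    move=> [V' [h [/step_revE[_ BV' _ V'E]]]]; rewrite taux => -[gh] _.
    by rewrite gh -V'E.
  move=> [BVg satVg]; exists (V `\ g), g; split=> //.
    by apply/step_revE; split=> //; exact: names_mem nV xs taux.
  have nVg := names_remove nV xs taux; split=> y => [|h] /(fsubsetP sphi) ys.
    by have [nam _ _] := nVg; have [h] := nam y ys; exists h.
  exact: names_mem nVg ys.
have eqRev phi : fi phi `<=` s `\ x ->
    config C (X `\ d) /\ sat C (X `\ d) rho phi <->
    config D (Y `\ d') /\ sat D (Y `\ d') sigma phi.
  move=> sphi; rewrite -!satRev //; apply: eqsat => /=.
  by rewrite fsubUset fsub1set xs (fsubset_trans sphi) ?fsubD1set.
(* With [ETrue] the test only asks whether the event can be undone. *)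
have [DYd' _] := (eqRev ETrue (fsub0set _)).1 (conj CXd I).
split=> //; try exact: names_remove.
  by move=> y e e'; rewrite !inE => /andP[_]; exact: lab.
by move=> phi /eqRev [h1 h2]; split=> sat1; [case: h1|case: h2].
Qed.

(** The finite conjunction of the Hennessy-Milner argument: [P] stands for truth at the target to be
    matched, [Q i] for truth at candidate [i], and each candidate contributes one distinguishing
    conjunct. *)
Lemma eil_conj (Id : choiceType) (Act : Type) (I : eqType) (l : seq I)
    (t : {fset Id}) (P : eil Id Act -> Prop) (Q : I -> eil Id Act -> Prop) :
    P ETrue -> (forall phi psi, P phi -> P psi -> P (EAnd phi psi)) ->
    (forall i phi psi, Q i (EAnd phi psi) -> Q i phi /\ Q i psi) ->
    (forall i, i \in l -> exists phi, [/\ fi phi `<=` t, P phi & ~ Q i phi]) ->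
  exists phi, [/\ fi phi `<=` t, P phi & forall i, i \in l -> ~ Q i phi].
Proof.
move=> PT PA QA; elim: l => [|i l IH] dist.
  by exists ETrue; split=> //; exact: fsub0set.
have [j jl|phi [sphi Pphi Qphi]] := IH.
  by apply: dist; rewrite inE jl orbT.
have [|psi [spsi Ppsi Qpsi]] := dist i; first by rewrite inE eqxx.
exists (EAnd psi phi); split; [by rewrite fsubUset spsi|exact: PA|].
by move=> j; rewrite inE => /orP[/eqP ->|/Qphi nQ] /QA[].
Qed.

(** If each of the finitely many candidate targets in [D] were distinguished from [X'], the
    conjunction [Phi] of the distinguishing formulas would make [EFwd z (label C e) Phi] true at [X]
    and false at [Y]. *)
Lemma matched_forward (Id : choiceType) (Act : Type) (E F : choiceType)
    (C : conf_struct Act E) (D : conf_struct Act F) (s : {fset Id})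
    X rho Y sigma X' e z :
  image_finite D -> matched C D s X rho Y sigma -> z \notin s ->
  step C X e X' ->
  exists Y' e', [/\ step D Y e' Y', label C e = label D e' &
    matched C D (z |` s) X' (update rho z e) Y' (update sigma z e')].
Proof.
move=> finD [[CX DY] nX nY lab eqsat] zs stX.
have /stepE[_ CX' eX X'E] := stX.
have /finite_seqP[l lE] := finD Y (label C e) DY.
have inl Y' e' : step D Y e' Y' -> label D e' = label C e -> Y' \in l.
  move=> st lb; suff : [set` l]%classic Y' by [].
  by rewrite -lE; exists e'.
apply: contrapT => nomatch.
pose P phi := sat C X' (update rho z e) phi.
(* The list [l] holds configurations only, so the added event is quantified here; [Qe] recovers it,
   as [Y] and [Y'] determine it. *)
pose Q Y' phi := exists e', [/\ step D Y e' Y', label D e' = label C e &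
  sat D Y' (update sigma z e') phi].
have [||||Phi [sPhi PPhi QPhi]] := @eil_conj Id Act _ l (z |` s) P Q.
- by [].
- by [].
- by move=> Y' phi psi [e' [st lb [? ?]]]; split; exists e'.
- move=> Y' Y'l; have [e' st lb] : lstep D Y (label C e) Y' by rewrite lE.
  have /stepE[_ DY' e'Y Y'E] := st.
  have Qe phi : Q Y' phi -> sat D Y' (update sigma z e') phi.
    move=> [e1 [/stepE[_ _ e1Y Y'E1] _]].
    suff -> : e1 = e' by [].
    have : e1 \in e' |` Y by rewrite -Y'E Y'E1 fset1U1.
    by rewrite !inE (negbTE e1Y) orbF => /eqP.
  apply: contrapT => nodist; apply: nomatch; exists Y', e'; split=> //.
  split=> //; [by rewrite X'E; exact: names_update|
    by rewrite Y'E; exact: names_update| |].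
    move=> x d d'; rewrite /update !inE.
    case: eqP => [_ _ [<-] [<-] //|_ xs]; exact: lab.
  (* A formula true at only one of the two targets distinguishes them, after negation if it is the
     candidate that satisfies it. *)
  move=> phi sphi; split=> satphi; apply: contrapT => nsat; apply: nodist.
    by exists phi; split=> // /Qe.
  by exists (ENot phi); split=> // /Qe.
have sfwd : fi (EFwd z (label C e) Phi) `<=` s.
  apply/fsubsetP=> y /=; rewrite !inE => /andP[yz /(fsubsetP sPhi)].
  by rewrite !inE (negbTE yz).
have [|Y' [e' [st lb satY']]] := (eqsat _ sfwd).1; first by exists X', e.
by apply: (QPhi Y'); [exact: inl lb|exists e'].
Qed.

(** Induction on the size of [X]: [stable_remove] finds an event outside [Z] to undo, and
    [matched_backward] undoes its namesake in [Y]. *)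
Lemma matched_subconfig (Id : choiceType) (Act : Type) (E F : choiceType)
    (C : conf_struct Act E) (D : conf_struct Act F) (s : {fset Id})
    X rho Y sigma Z :
  stable C -> matched C D s X rho Y sigma -> config C Z -> Z `<=` X ->
  exists W, [/\ config D W, W `<=` Y & forall x d d', x \in s ->
    rho x = Some d -> sigma x = Some d' -> (d \in Z) = (d' \in W)].
Proof.
move=> stC + CZ; have [n] := ubnP #|` X|.
elim: n => // n IH in s X Y * => cardX mat sZX.
have [[CX DY] nX nY _ _] := mat.
have [ZX|neqZX] := eqVneq Z X.
  exists Y; split=> // x d d' xs rhox sigmax.
  by rewrite ZX (names_mem nX xs rhox) (names_mem nY xs sigmax).
have [|e [eX eZ CXe]] := stable_remove stC CX CZ.
  by rewrite fproperEneq neqZX.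
have [_ surX _] := nX; have [namY _ _] := nY.
have [x xs rhox] := surX e eX; have [e' e'Y sigmax] := namY x xs.
have [||W [DW sWY memW]] := IH _ _ _ _
    (matched_backward mat xs rhox sigmax CXe).
- by move: cardX; rewrite (cardfsD1 e X) eX.
- by rewrite fsubsetD1 sZX.
exists W; split=> //; first by rewrite (fsubset_trans sWY) ?fsubD1set.
move=> y d d' ys rhoy sigmay; have [yx|yx] := eqVneq y x; last first.
  by apply: (memW y) => //; rewrite !inE yx.
move: rhoy sigmay; rewrite yx rhox sigmax => -[<-] [<-]; rewrite (negbTE eZ).
by apply/esym/negP => /(fsubsetP sWY); rewrite !inE eqxx.
Qed.

(** Subconfigurations travel against the order: any [Z] testing [d] below [e] is carried to some [W]
    inside [Y], where the hypothesis on [d'] and [e'] applies. *)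
Lemma matched_le (Id : choiceType) (Act : Type) (E F : choiceType)
    (C : conf_struct Act E) (D : conf_struct Act F) (s : {fset Id})
    X rho Y sigma x y d d' e e' :
  stable C -> matched C D s X rho Y sigma ->
  x \in s -> rho x = Some d -> sigma x = Some d' ->
  y \in s -> rho y = Some e -> sigma y = Some e' ->
  event_lt D Y d' e' -> event_lt C X d e.
Proof.
move=> stC mat xs rhox sigmax ys rhoy sigmay [le neq]; split=> [Z CZ sZX|de].
  have [W [DW sWY memW]] := matched_subconfig stC mat CZ sZX.
  rewrite (memW _ _ _ xs rhox sigmax) (memW _ _ _ ys rhoy sigmay); exact: le.
apply: neq; have [_ [_ _ inj] _ _ _] := mat.
have xy : x = y by apply: (inj _ _ d); rewrite // de.
by move: sigmax; rewrite xy sigmay => -[].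
Qed.

(** * The isomorphism read off the names *)

Definition named_graph (Id E F : choiceType) (s : {fset Id}) (rho : env Id E)
    (sigma : env Id F) : set (E * F) :=
  [set p | exists x, [/\ x \in s, rho x = Some p.1 & sigma x = Some p.2]]%classic.

Lemma flip_named_graph (Id E F : choiceType) (s : {fset Id}) (rho : env Id E)
    (sigma : env Id F) :
  flip (named_graph s rho sigma) = named_graph s sigma rho.
Proof. by apply/seteqP; split=> -[d' d] [x [? ? ?]]; exists x. Qed.

Lemma matched_iso (Id : choiceType) (Act : Type) (E F : choiceType)
    (C : conf_struct Act E) (D : conf_struct Act F) (s : {fset Id})
    X rho Y sigma :
  stable C -> stable D -> matched C D s X rho Y sigma ->
  conf_iso C D X Y (named_graph s rho sigma).
Proof.
move=> stC stD mat; have [_ nX nY lab _] := mat.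
have bij (G H : choiceType) V W (tau : env Id G) (ups : env Id H) g :
    names s tau V -> names s ups W -> g \in V ->
    exists! h, named_graph s tau ups (g, h).
  move=> [_ sur inj] [nam _ _] gV; have [x xs taux] := sur g gV.
  have [h _ upsx] := nam x xs; exists h; split; first by exists x.
  move=> h' [y /= [ys tauy upsy]].
  by move: upsy; rewrite -(inj _ _ _ xs ys taux tauy) upsx => -[].
split; first split.
- by move=> d d' [x /= [xs /(names_mem nX xs) ? /(names_mem nY xs) ?]].
- by move=> d; exact: (bij _ _ _ _ _ _ _ nX nY).
- move=> d' d'Y; have := bij _ _ _ _ _ _ _ nY nX d'Y.
  by rewrite -flip_named_graph.
- by move=> d d' [x /= [xs rhox sigmax]]; exact: (lab x).
- move=> d e d' e' [x /= [xs rhox sigmax]] [y /= [ys rhoy sigmay]]; split.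
    exact: (matched_le stD (matched_sym mat) xs sigmax rhox ys sigmay rhoy).
  exact: (matched_le stC mat xs rhox sigmax ys rhoy sigmay).
Qed.

(** Serves both kinds of moves: forward, [t] adds a fresh identifier to [s] and the environments are
    updated there; backward, [s] drops an identifier of [t] and the environments stay the same. *)
Lemma restrict_named_graph (Id E F : choiceType) (s t : {fset Id})
    (rho rho' : env Id E) (sigma sigma' : env Id F) (X X' : {fset E}) :
  names s rho X -> names t rho' X' -> s `<=` t ->
  {in s, rho =1 rho'} -> {in s, sigma =1 sigma'} ->
  restrict_dom (named_graph t rho' sigma') X = named_graph s rho sigma.
Proof.
move=> nX nX' sst eqr eqs; apply/seteqP; split=> -[d d'] /=.
  move=> [[x /= [xt rhox sigmax]] dX].
  have [_ sur _] := nX; have [_ _ inj] := nX'; have [y ys rhoy] := sur d dX.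
  have yx : y = x.
    by apply: (inj y x d) => //; [exact: (fsubsetP sst)|rewrite -eqr].
  by exists y; split; rewrite //= eqs // yx.
move=> [x /= [xs rhox sigmax]]; split; last exact: names_mem nX xs rhox.
by exists x; rewrite -eqr // -eqs // (fsubsetP sst).
Qed.

(** * Logical equivalence yields a bisimulation *)

Lemma infinite_fresh (T : choiceType) (s : {fset T}) :
  infinite_set [set: T]%classic -> exists z, z \notin s.
Proof.
move=> infT; apply: contrapT => nofresh; apply: infT.
apply/finite_seqP; exists s; apply/seteqP; split=> // z _ /=.
by apply: contrapT => /negP zs; apply: nofresh; exists z.
Qed.

Lemma update_fresh (Id : choiceType) (E : Type) (s : {fset Id}) (rho : env Id E)
    z e :
  z \notin s -> {in s, rho =1 update rho z e}.
Proof. by move=> zs x xs; rewrite /update; case: eqP zs => // <-; rewrite xs. Qed.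

Lemma logic_equiv_HH (Act : Type) (Id : choiceType) (E F : choiceType)
    (C : conf_struct Act E) (D : conf_struct Act F) :
  infinite_set [set: Id]%classic -> stable C -> stable D ->
  image_finite C -> image_finite D ->
  logic_equiv [set: eil Id Act]%classic C D -> HH_bisimilar C D.
Proof.
move=> infId stC stD finC finD eqCD.
exists (fun X Y f => exists (s : {fset Id}) rho sigma,
  matched C D s X rho Y sigma /\ f = named_graph s rho sigma).
split.
  (* With no identifier in use, the formulas to compare are exactly the closed ones. *)
  exists fset0, (@empty_env Id E), (@empty_env Id F); split; last first.
    by apply/seteqP; split=> // p [x []].
  have [C0 _ _] := stC; have [D0 _ _] := stD.
  by split=> // phi; rewrite fsubset0 => /eqP; exact: eqCD.
move=> X Y f [s [rho [sigma [mat ->]]]].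
have [[CX DY] nX nY lab _] := mat; split=> //; first exact: matched_iso.
- have [z zs] := infinite_fresh s infId.
  have grow X' Y' e e' :
      matched C D (z |` s) X' (update rho z e) Y' (update sigma z e') ->
      restrict_dom
        (named_graph (z |` s) (update rho z e) (update sigma z e')) X =
      named_graph s rho sigma.
    move=> [_ nX' _ _ _]; apply: (restrict_named_graph nX nX').
    + exact: fsubsetU1.
    + exact: update_fresh.
    + exact: update_fresh.
  move=> a; split.
    move=> X' [e st <-].
    have [Y' [e' [st' lb mat']]] := matched_forward finD mat zs st.
    exists Y', (named_graph (z |` s) (update rho z e) (update sigma z e')).
    split; [by exists e'| |exact: grow mat'].
    by exists (z |` s), (update rho z e), (update sigma z e').
  move=> Y' [e' st' <-].
  have [X' [e [st lb /matched_sym mat']]] :=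
    matched_forward finC (matched_sym mat) zs st'.
  exists X', (named_graph (z |` s) (update rho z e) (update sigma z e')).
  split; [by exists e| |exact: grow mat'].
  by exists (z |` s), (update rho z e), (update sigma z e').
- have shrink x d : x \in s -> rho x = Some d ->
      restrict_dom (named_graph s rho sigma) (X `\ d) =
      named_graph (s `\ x) rho sigma.
    move=> xs rhox; apply: (restrict_named_graph (names_remove nX xs rhox) nX) => //.
    by rewrite fsubD1set.
  have [namX surX _] := nX; have [namY surY _] := nY.
  move=> a; split.
    move=> X' [d /step_revE[_ CX' dX X'E] <-]; rewrite X'E in CX' *.
    have [x xs rhox] := surX d dX; have [d' d'Y sigmax] := namY x xs.
    have mat' := matched_backward mat xs rhox sigmax CX'.
    exists (Y `\ d'), (named_graph (s `\ x) rho sigma); split.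
    + exists d'; last by rewrite (lab x d d').
      by have [[_ DY'] _ _ _ _] := mat'; apply/step_revE.
    + by exists (s `\ x), rho, sigma.
    + exact: shrink rhox.
  move=> Y' [d' /step_revE[_ DY' d'Y Y'E] <-]; rewrite Y'E in DY' *.
  have [x xs sigmax] := surY d' d'Y; have [d dX rhox] := namX x xs.
  have mat' := matched_sym (matched_backward (matched_sym mat) xs sigmax rhox DY').
  exists (X `\ d), (named_graph (s `\ x) rho sigma); split.
  + exists d; last by rewrite (lab x d d').
    by have [[CX' _] _ _ _ _] := mat'; apply/step_revE.
  + by exists (s `\ x), rho, sigma.
  + exact: shrink rhox.
Qed.

Theorem theorem1 (Act : Type) (Id : choiceType)
    (Id_infinite : infinite_set [set: Id]%classic)
    (E F : choiceType) (C : conf_struct Act E) (D : conf_struct Act F)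
    (C_stable : stable C) (D_stable : stable D)
    (C_image_finite : image_finite C) (D_image_finite : image_finite D) :
  HH_bisimilar C D <-> logic_equiv [set: eil Id Act]%classic C D.
Proof.
split; last exact: logic_equiv_HH.
by move=> bisim phi _; exact: HH_bisimilar_models.
Qed.
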